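(* Let $\{v_k\}_{k=0}^K$, $v_k:[0,T]\to V$, solve the quasi-time discretization, i.e. for every $k=1,\dots,K$, every $t\in(0,T]$ and every $w\in V$, $$(\ddot v_k,w;z_k)_c+\frac{1}{\Delta z}\,(\dot v_k-\dot v_{k-1},w)+\frac12\,a(v_k,w;z_k)=0 .$$ Then the following stability estimate holds: $$\|\dot v_K\|_{L^2(0,T;L^2(\Omega))}^2+\Delta z\sum_{k=1}^K\mathcal E_k(v_k(T))\lesssim \|\dot v_0\|_{L^2(0,T;L^2(\Omega))}^2+\Delta z\sum_{k=1}^K\mathcal E_k(v_k(0)),$$ where $\mathcal E_k(v):=\|\dot v\|_{c(z_k)}^2+\frac12\|v\|_{a(z_k)}^2$, and $\mathcal E_k(v_k(t))$ means $\|\dot v_k(t)\|_{c(z_k)}^2+\frac12\|v_k(t)\|_{a(z_k)}^2$.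
   Context: $\Omega\subset\mathbb R^2$ is a bounded domain, $D=[d_1,d_2]\subset\mathbb R$, $T>0$, $V:=H_0^1(\Omega)$. The coefficient $c=c(z,x)$ is a positive function in $L^\infty(D\times\Omega)$, bounded below by a positive constant, and $c(z_k)$ denotes $c(z_k,\cdot)$. $K$ is a positive integer, $\Delta z=(d_2-d_1)/K$, and $z_k=d_1+k\Delta z$ for $k=0,\dots,K$. A dot denotes the derivative in $t$ and two dots the second derivative in $t$. The functions $v_k$ are regular enough in time for the equation to make sense with test functions $w=\dot v_k(t)\in V$ (e.g. $v_k\in C^2([0,T];V)$). Notation: $(v,w;z_k)_c:=\int_\Omega c(z_k)^{-1}vw\,dx$, $(v,w):=\int_\Omega vw\,dx$, $a(v,w;z_k):=\int_\Omega c(z_k)\nabla v\cdot\nabla w\,dx$; $\|v\|:=\sqrt{(v,v)}$, $\|v\|_{c(z_k)}:=\sqrt{(v,v;z_k)_c}$, $\|v\|_{a(z_k)}:=\sqrt{a(v,v;z_k)}$. $A\lesssim B$ means $A\le CB$ with a constant $C>0$ independent of $K$, $\Delta z$ and of the functions $v_k$. *)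

(* Defs.v *)
From HB Require Import structures.
From mathcomp Require Import all_boot all_order all_algebra.
From mathcomp Require Import all_classical all_reals all_analysis.

Set Implicit Arguments.
Unset Strict Implicit.
Unset Printing Implicit Defensive.

Import Order.TTheory GRing.Theory Num.Theory.
Import numFieldNormedType.Exports.

Local Open Scope classical_set_scope.
Local Open Scope ring_scope.

Notation leb2 R := (@lebesgue_measure R \x @lebesgue_measure R)%E.

Definition bounded_domain (R : realType) (Om : set (R * R)) : Prop :=
  [/\ open Om, connected Om, Om !=set0 & bounded_set Om].

(* [L2 Om f]: the extension by zero of the restriction of f to Om is in
   L^2(R^2). As usual, elements of L^2(Om) are represented by functions, whose
   values outside Om play no role. *)
Definition L2 (R : realType) (Om : set (R * R)) (f : R * R -> R) : Prop :=
  (f \_ Om) \in Lfun (leb2 R) 2%:E.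

Definition L2ip (R : realType) (Om : set (R * R)) (f g : R * R -> R) : R :=
  \int[leb2 R]_(x in Om) (f x * g x).

Definition L2norm (R : realType) (Om : set (R * R)) (f : R * R -> R) : R :=
  Num.sqrt (L2ip Om f f).

(* All iterated directional derivatives are differentiable, i.e., f is C^oo. *)
Definition smooth (R : realType) (f : R * R -> R) : Prop :=
  forall (s : seq (R * R)) (x : R * R),
    differentiable (foldr (fun e g => 'D_e g) f s) x.

Definition partial1 (R : realType) (f : R * R -> R) : R * R -> R :=
  'D_((1, 0) : R * R) f.

Definition partial2 (R : realType) (f : R * R -> R) : R * R -> R :=
  'D_((0, 1) : R * R) f.

(* C_c^oo(Om), functions being extended by zero to R^2. *)
Definition test_fun (R : realType) (Om : set (R * R)) (phi : R * R -> R) : Prop :=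
  [/\ smooth phi, compact (closure [set x | phi x != 0])
    & closure [set x | phi x != 0] `<=` Om].

(* A function together with its two weak partial derivatives: [u] stands for
   (u, d_1 u, d_2 u). The weak derivatives are determined a.e. by the function,
   so that carrying them along adds no information; it only fixes
   representatives. *)
Notation jet R := ((R * R -> R) * (R * R -> R) * (R * R -> R))%type.

Definition jval (R : realType) (u : jet R) : R * R -> R := u.1.1.
Definition jd1 (R : realType) (u : jet R) : R * R -> R := u.1.2.
Definition jd2 (R : realType) (u : jet R) : R * R -> R := u.2.

Definition jet_of (R : realType) (phi : R * R -> R) : jet R :=
  (phi, partial1 phi, partial2 phi).

Definition weak_gradient (R : realType) (Om : set (R * R))
    (u g1 g2 : R * R -> R) : Prop :=
  forall phi, test_fun Om phi ->
    L2ip Om u (partial1 phi) = - L2ip Om g1 phi /\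
    L2ip Om u (partial2 phi) = - L2ip Om g2 phi.

Definition H1 (R : realType) (Om : set (R * R)) (u : jet R) : Prop :=
  [/\ L2 Om (jval u), L2 Om (jd1 u), L2 Om (jd2 u)
    & weak_gradient Om (jval u) (jd1 u) (jd2 u)].

Definition H1norm (R : realType) (Om : set (R * R)) (u : jet R) : R :=
  Num.sqrt (L2norm Om (jval u) ^+ 2 + L2norm Om (jd1 u) ^+ 2
            + L2norm Om (jd2 u) ^+ 2).

(* H_0^1(Om): the closure of C_c^oo(Om) in H^1(Om). *)
Definition H10 (R : realType) (Om : set (R * R)) (u : jet R) : Prop :=
  H1 Om u /\
  forall e : R, 0 < e ->
    exists2 phi, test_fun Om phi & H1norm Om (u - jet_of phi) < e.

(* v is continuously differentiable on [0, T] (one-sidedly at the endpoints)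
   with derivative dv, with respect to the seminorm N on E. *)
Definition C1_on (R : realType) (E : lmodType R) (N : E -> R) (T : R)
    (v dv : R -> E) : Prop :=
  forall t, t \in `[0, T] ->
    (N ((s - t)^-1 *: (v s - v t) - dv t)
       @[s --> within `[0, T] (dnbhs t)] --> (0 : R)) /\
    (N (dv s - dv t) @[s --> within `[0, T] (nbhs t)] --> (0 : R)).

(* v in C^1([0,T]; H_0^1(Om)) and v in C^2([0,T]; L^2(Om)), with first
   derivative dv and second derivative ddv; in particular this holds for v in
   C^2([0,T]; H_0^1(Om)). *)
Definition time_regular (R : realType) (Om : set (R * R)) (T : R)
    (v dv : R -> jet R) (ddv : R -> R * R -> R) : Prop :=
  [/\ forall t, t \in `[0, T] ->
        [/\ H10 Om (v t), H10 Om (dv t) & L2 Om (ddv t)],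
      C1_on (H1norm Om) T v dv
    & C1_on (E := R * R -> R) (L2norm Om) T (fun t => jval (dv t)) ddv].

(* The bounds are required on each slice c(z, .), z in [d1, d2], and not merely
   for almost every (z, x): a slice is a null set of [d1, d2] x Om, and the
   slices at the nodes z_k occur in the equations. Together with measurability,
   they imply that c is in L^oo([d1, d2] x Om). *)
Definition coefficient (R : realType) (Om : set (R * R)) (d1 d2 : R)
    (c : R -> R * R -> R) : Prop :=
  measurable_fun (`[d1, d2] `*` Om) (fun p : R * (R * R) => c p.1 p.2) /\
  exists c0 c1 : R, 0 < c0 /\
    forall z, z \in `[d1, d2] ->
      {ae leb2 R, forall x, Om x -> c0 <= c z x <= c1}.

Section forms.
Variables (R : realType) (Om : set (R * R)) (c : R -> R * R -> R) (z : R).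

Definition cform (f g : R * R -> R) : R :=
  \int[leb2 R]_(x in Om) ((c z x)^-1 * f x * g x).

Definition aform (u w : jet R) : R :=
  \int[leb2 R]_(x in Om) (c z x * (jd1 u x * jd1 w x + jd2 u x * jd2 w x)).

Definition cnorm (f : R * R -> R) : R := Num.sqrt (cform f f).

Definition anorm (u : jet R) : R := Num.sqrt (aform u u).

Definition energy (u du : jet R) : R :=
  cnorm (jval du) ^+ 2 + 2^-1 * anorm u ^+ 2.

End forms.

(* The norm of L^2(0,T; L^2(Om)). *)
Definition L2L2norm (R : realType) (Om : set (R * R)) (T : R)
    (f : R -> R * R -> R) : R :=
  Num.sqrt (\int[@lebesgue_measure R]_(t in `]0, T[) (L2norm Om (f t) ^+ 2)).

Definition dz (R : realType) (d1 d2 : R) (K : nat) : R := (d2 - d1) / K%:R.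

Definition node (R : realType) (d1 d2 : R) (K k : nat) : R :=
  d1 + k%:R * dz d1 d2 K.

Definition quasi_time_discretization (R : realType) (Om : set (R * R))
    (d1 d2 T : R) (c : R -> R * R -> R) (K : nat)
    (v dv : nat -> R -> jet R) (ddv : nat -> R -> R * R -> R) : Prop :=
  forall (k : nat) (t : R) (w : jet R),
    (1 <= k <= K)%N -> t \in `]0, T] -> H10 Om w ->
    cform Om c (node d1 d2 K k) (ddv k t) (jval w)
    + (dz d1 d2 K)^-1 * L2ip Om (jval (dv k t) - jval (dv k.-1 t)) (jval w)
    + 2^-1 * aform Om c (node d1 d2 K k) (v k t) w = 0.

(* Main.v *)
Require Import Defs.
From HB Require Import structures.
From mathcomp Require Import all_boot all_order all_algebra.
From mathcomp Require Import all_classical all_reals all_analysis.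
From mathcomp Require Import measurable_realfun ring lra.
Import Order.TTheory GRing.Theory Num.Theory.
Import numFieldNormedType.Exports.
Local Open Scope classical_set_scope.
Local Open Scope ring_scope.

(** The estimate holds with C = 1. The velocity of the k-th solution is an
    admissible test function, and testing the k-th equation with it gives
      d/dt E_k + (2 / dz) (dv_k - dv_(k-1), dv_k) = 0,
    where E_k is the energy at the node z_k. Since the square of
    dv_k - dv_(k-1) has a nonnegative integral,
      2 (dv_k - dv_(k-1), dv_k) >= |dv_k|^2 - |dv_(k-1)|^2,
    so that dz * d/dt E_k <= |dv_(k-1)|^2 - |dv_k|^2 ([energy_dissipation]).
    The right-hand side telescopes in k, and integration over [0, T] yields the
    claim ([velocity_energy_stability]).

    The point that needs care is the time derivative of the energy, since the
    solutions are differentiable in time only for the norms of H^1 and L^2.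
    Each term of the energy is a positive semidefinite form B dominated by a
    form G whose square root is the norm of differentiability. By the
    Cauchy-Schwarz inequality such a B is continuous for that norm, hence
    t |-> B (v t) (v t) is C^1 with derivative 2 B (v t) (dv t)
    ([C1_on_form]). That the forms at hand have these properties is an
    integrability statement about weights bounded almost everywhere
    ([weight_form_psd], [weight_form_le]). *)

(** * Positive semidefinite forms *)

(** The form is only required to behave on the subspace [S]: an integral of a
    product is bilinear on L^2, not on all functions. *)
Definition psd_form {R : realType} {E : lmodType R} (S : E -> Prop)
    (B : E -> E -> R) : Prop :=
  [/\ forall u w, S u -> S w -> B u w = B w u,
      forall a u v w, S u -> S v -> S w ->
        B (a *: u + v) w = a * B u w + B v w
    & forall u, S u -> 0 <= B u u].

Definition lin_closed {R : realType} {E : lmodType R} (S : E -> Prop) : Prop :=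
  forall (a : R) u v, S u -> S v -> S (a *: u + v).

Lemma psd_form_add (R : realType) (E : lmodType R) (S : E -> Prop)
    (B B' : E -> E -> R) :
  psd_form S B -> psd_form S B' ->
  psd_form S (fun u w => B u w + B' u w).
Proof.
move=> [BC Blin B0] [BC' Blin' B0']; split.
- by move=> u w Su Sw; rewrite BC// BC'.
- by move=> a u v w Su Sv Sw; rewrite Blin// Blin'//; ring.
- by move=> u Su; rewrite addr_ge0 ?B0 ?B0'.
Qed.

Lemma psd_form_comap (R : realType) (E F : lmodType R) (S : E -> Prop)
    (S' : F -> Prop) (B : F -> F -> R) (phi : E -> F) :
  (forall (a : R) u v, phi (a *: u + v) = a *: phi u + phi v) ->
  (forall u, S u -> S' (phi u)) -> psd_form S' B ->
  psd_form S (fun u w => B (phi u) (phi w)).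
Proof.
move=> philin Sphi [BC Blin B0]; split.
- by move=> u w Su Sw; apply: BC; exact: Sphi.
- by move=> a u v w Su Sv Sw; rewrite philin Blin//; exact: Sphi.
- by move=> u Su; exact/B0/Sphi.
Qed.

Section PsdForm.
Context {R : realType} {E : lmodType R} (S : E -> Prop).
Hypothesis hS : lin_closed S.

Lemma lin_closedB u v : S u -> S v -> S (u - v).
Proof. by move=> Su Sv; rewrite addrC -scaleN1r; exact: hS. Qed.

Lemma lin_closed0 u : S u -> S 0.
Proof. by move=> Su; rewrite -(subrr u); exact: lin_closedB. Qed.

Lemma lin_closedD u v : S u -> S v -> S (u + v).
Proof. by move=> Su Sv; rewrite -[u]scale1r; exact: hS. Qed.

Lemma lin_closedZ a u : S u -> S (a *: u).
Proof. by move=> Su; rewrite -[_ *: _]addr0; apply/hS/(lin_closed0 u). Qed.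

Section OneForm.
Variable B : E -> E -> R.
Hypothesis hB : psd_form S B.

Let BC u w : S u -> S w -> B u w = B w u.
Proof. by case: hB => + _ _; exact. Qed.

Let Blin a u v w : S u -> S v -> S w -> B (a *: u + v) w = a * B u w + B v w.
Proof. by case: hB => _ + _; exact. Qed.
Let Bge0 u : S u -> 0 <= B u u. Proof. by case: hB => _ _; exact. Qed.

Lemma psd_formD u v w : S u -> S v -> S w -> B (u + v) w = B u w + B v w.
Proof. by move=> Su Sv Sw; rewrite -[u in LHS]scale1r Blin// mul1r. Qed.

Lemma psd_formB u v w : S u -> S v -> S w -> B (u - v) w = B u w - B v w.
Proof. by move=> Su Sv Sw; rewrite addrC -scaleN1r Blin// mulN1r addrC. Qed.

Lemma psd_formZ a u w : S u -> S w -> B (a *: u) w = a * B u w.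
Proof.
move=> Su Sw.
have S0 := lin_closed0 _ Su.
have B0 : B 0 w = 0 by have := psd_formB _ _ _ Su Su Sw; rewrite !subrr.
by rewrite -[_ *: _]addr0 Blin// B0 addr0.
Qed.

Lemma psd_formDr u v w : S u -> S v -> S w -> B w (u + v) = B w u + B w v.
Proof.
move=> Su Sv Sw; rewrite BC//; last exact: lin_closedD.
by rewrite psd_formD// [B u _]BC// [B v _]BC.
Qed.

Lemma psd_formZr a u w : S u -> S w -> B w (a *: u) = a * B w u.
Proof.
by move=> Su Sw; rewrite BC//; [rewrite psd_formZ// BC|exact: lin_closedZ].
Qed.

Let quad a b u w : S u -> S w ->
  0 <= a ^+ 2 * B u u + 2 * a * b * B u w + b ^+ 2 * B w w.
Proof.
move=> Su Sw.
have Sau := lin_closedZ a _ Su; have Sbw := lin_closedZ b _ Sw.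
have := Bge0 _ (lin_closedD _ _ Sau Sbw).
rewrite psd_formD ?psd_formDr//; last exact: lin_closedD.
rewrite !psd_formZ// !psd_formZr// (BC w u)//.
by congr (_ <= _); ring.
Qed.

Lemma psd_form_Cauchy_Schwarz u w : S u -> S w ->
  B u w ^+ 2 <= B u u * B w w.
Proof.
move=> Su Sw.
have u0 := Bge0 _ Su; have w0 := Bge0 _ Sw.
have discr a b : 0 < a -> 0 <= a ^+ 2 * b - a * B u w ^+ 2 ->
    B u w ^+ 2 <= a * b.
  by move=> a0; rewrite expr2 -mulrA -mulrBr pmulr_rge0// subr_ge0.
have [uu|uu] := eqVneq (B u u) 0.
  have [ww|ww] := eqVneq (B w w) 0.
    (* both squares vanish: [B u w] is then bounded by 0 in both directions *)
    have h1 := quad 1 1 _ _ Su Sw; have h2 := quad 1 (-1) _ _ Su Sw.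
    move: h1 h2; rewrite uu ww => h1 h2.
    have -> : B u w = 0 by lra.
    by rewrite expr0n mulr0.
  have wgt0 : 0 < B w w by rewrite lt_def ww.
  rewrite mulrC; apply: discr => //.
  by have := quad (B w w) (- B u w) _ _ Su Sw; congr (_ <= _); ring.
have ugt0 : 0 < B u u by rewrite lt_def uu.
apply: discr => //.
by have := quad (- B u w) (B u u) _ _ Su Sw; congr (_ <= _); ring.
Qed.

End OneForm.

Variables (B G : E -> E -> R) (M : R).
Hypotheses (hB : psd_form S B) (hG : psd_form S G).
Hypotheses (M0 : 0 <= M) (BG : forall u, S u -> B u u <= M * G u u).

Let N u := Num.sqrt (G u u).

(** Domination of the squares passes to the mixed values by the Cauchy-Schwarz
    inequality. *)
Lemma psd_form_bounded u w : S u -> S w -> `|B u w| <= M * (N u * N w).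
Proof.
move=> Su Sw.
have Gu : 0 <= G u u by case: hG => _ _; exact.
have Gw : 0 <= G w w by case: hG => _ _; exact.
have Bu : 0 <= B u u by case: hB => _ _; exact.
have Bw : 0 <= B w w by case: hB => _ _; exact.
rewrite -ler_sqr ?nnegrE ?mulr_ge0 ?sqrtr_ge0//.
rewrite real_normK ?num_real//.
apply: le_trans (psd_form_Cauchy_Schwarz _ hB _ _ Su Sw) _.
rewrite !exprMn !sqr_sqrtr//.
have -> : M ^+ 2 * (G u u * G w w) = (M * G u u) * (M * G w w) by ring.
by apply: ler_pM => //; exact: BG.
Qed.

(** A dominated form is continuous for the seminorm of the dominating form:
    B p q - B p0 q0 is the sum of the three mixed values of the increments
    p - p0 and q - q0, among themselves and with q0 and p0. *)
Lemma psd_form_cvg (F : set_system R) {FF : Filter F} (p q : R -> E)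
    (p0 q0 : E) :
  S p0 -> S q0 ->
  (\forall s \near F, S (p s)) -> (\forall s \near F, S (q s)) ->
  N (p s - p0) @[s --> F] --> (0 : R) -> N (q s - q0) @[s --> F] --> (0 : R) ->
  B (p s) (q s) @[s --> F] --> B p0 q0.
Proof.
move=> Sp0 Sq0 Sp Sq Np Nq.
pose e s := M * (N (p s - p0) * N (q s - q0)) + M * (N (p s - p0) * N q0)
            + M * (N (q s - q0) * N p0).
have e0 : e s @[s --> F] --> (0 : R).
  rewrite [X in _ --> X](_ : _ = M * (0 * 0) + M * (0 * N q0) + M * (0 * N p0)).
    apply: cvgD; [apply: cvgD|]; apply: cvgMr.
    - exact: cvgM.
    - exact: cvgMl.
    - exact: cvgMl.
  by rewrite !mul0r !mulr0 !addr0.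
have near_le : \forall s \near F, `|B (p s) (q s) - B p0 q0| <= e s.
  near=> s.
  have Sps : S (p s) by near: s.
  have Sqs : S (q s) by near: s.
  have Sdp := lin_closedB _ _ Sps Sp0; have Sdq := lin_closedB _ _ Sqs Sq0.
  have -> : B (p s) (q s) - B p0 q0 =
      B (p s - p0) (q s - q0) + B (p s - p0) q0 + B (q s - q0) p0.
    rewrite !psd_formB//; have [BC _ _] := hB.
    rewrite (BC _ (q s - q0))// (BC p0 (q s - q0))// !psd_formB//.
    by rewrite (BC _ p0)// (BC (q s))// (BC q0 (p s))//; ring.
  rewrite (le_trans (ler_normD _ _))// lerD ?psd_form_bounded//.
  by rewrite (le_trans (ler_normD _ _))// lerD ?psd_form_bounded.
apply/cvgrPdist_le => eps eps0.
have : \forall s \near F, `|0 - e s| <= eps by move/cvgrPdist_le : e0; exact.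
apply: filterS2 near_le => s le1; rewrite sub0r normrN => le2.
by rewrite distrC (le_trans le1)// (le_trans _ le2)// ler_norm.
Unshelve. all: by end_near. Qed.

End PsdForm.

(** * Real functions of class C^1 on a segment *)

Definition nbhs_within {R : realType} (A : set R) (t : R) : set_system R :=
  within A (nbhs t).

Definition dnbhs_within {R : realType} (A : set R) (t : R) : set_system R :=
  within A (dnbhs t).

#[local] Instance nbhs_within_filter (R : realType) (A : set R) (t : R) :
  Filter (nbhs_within A t).
Proof. exact: within_filter. Qed.

#[local] Instance dnbhs_within_filter (R : realType) (A : set R) (t : R) :
  Filter (dnbhs_within A t).
Proof. exact: within_filter. Qed.

Definition C1_scalar {R : realType} (T : R) (f f' : R -> R) : Prop :=
  forall t : R, t \in `[0, T] ->
    ((s - t)^-1 * (f s - f t) @[s --> dnbhs_within `[0, T] t] --> f' t) /\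
    (f' s @[s --> nbhs_within `[0, T] t] --> f' t).

Section C1Scalar.
Context {R : realType} (T : R).
Implicit Types (f : R -> R) (t : R).

Lemma cvg_dnbhs_within (A : set R) f t :
  f s @[s --> dnbhs_within A t] --> f t ->
  f s @[s --> nbhs_within A t] --> f t.
Proof.
move=> ft; apply/cvgrPdist_le => e e0.
have h : nbhs t [set s | s != t -> A s -> `|f t - f s| <= e].
  by have /cvgrPdist_le/(_ _ e0) := ft.
apply: (filterS _ h : nbhs t [set s | A s -> `|f t - f s| <= e]) => {h} s h As.
by have [->|st] := eqVneq s t; [rewrite subrr normr0 ltW|exact: h].
Qed.

Lemma cvg_dnbhs_within_sub (A : set R) t :
  s - t @[s --> dnbhs_within A t] --> (0 : R).
Proof.
apply: cvg_within_filter; apply: cvg_within_filter.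
have : s - t @[s --> t] --> t - t.
  by apply: cvgB; [exact: cvg_id|exact: cvg_cst].
by rewrite subrr.
Qed.

Lemma dnbhs_within_neq (A : set R) t : \forall s \near dnbhs_within A t, s != t.
Proof. by apply: cvg_within; exact: withinT. Qed.

Lemma C1_scalar_continuous f f' : C1_scalar T f f' ->
  {within `[0, T], continuous f}.
Proof.
move=> hf; apply/subspace_continuousP => t tT; apply: cvg_dnbhs_within.
have [q _] := hf t tT.
have : (s - t) * ((s - t)^-1 * (f s - f t)) + f t
       @[s --> dnbhs_within `[0, T] t] --> 0 * f' t + f t.
  by apply: cvgD; [exact: cvgM (cvg_dnbhs_within_sub _ _) q|exact: cvg_cst].
rewrite mul0r add0r; apply: cvg_trans.
apply: near_eq_cvg; apply: filterS (dnbhs_within_neq _ _) => s st.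
by rewrite mulVKf ?subr_eq0// subrK.
Qed.

Lemma C1_scalar_is_derive f f' t : C1_scalar T f f' -> t \in `]0, T[ ->
  is_derive t 1 f (f' t).
Proof.
move=> hf tT.
have tT' : t \in `[0, T] by apply: subset_itv_oo_cc tT.
have [q _] := hf t tT'.
have oT : \forall s \near t, s \in `[0, T].
  by apply: filterS (near_in_itvoo tT) => s; exact: subset_itv_oo_cc.
have lim : h^-1 *: ((f \o shift t) (h *: 1) - f t) @[h --> 0^'] --> f' t.
  apply/cvgrPdist_le => e e0.
  have {}q : nbhs t [set s | s != t -> s \in `[0, T] ->
      `|f' t - (s - t)^-1 * (f s - f t)| <= e].
    by move/cvgrPdist_le : q => /(_ _ e0).
  have [r /= r0 hr] : nbhs t [set s | s != t ->
      `|f' t - (s - t)^-1 * (f s - f t)| <= e].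
    by apply: filterS2 oT q => s sT qs st; exact: qs.
  exists r => //= h hr' h0.
  have /= := hr (h + t); rewrite addrK /shift/= scaler1 => -> //.
  - rewrite /ball/= opprD addrCA subrr addr0.
    by move: hr'; rewrite /ball/= sub0r.
  - by rewrite -subr_eq0 addrK.
split; first by apply/cvg_ex; exists (f' t).
exact/cvg_lim.
Qed.

Lemma continuous_integrable f : {within `[0, T], continuous f} ->
  (@lebesgue_measure R).-integrable `]0, T[ (EFin \o f).
Proof.
move=> cf.
have if' : (@lebesgue_measure R).-integrable `[0, T] (EFin \o f).
  by apply: continuous_compact_integrable => //; exact: segment_compact.
by apply: integrableS if' => //; apply: subset_itv; rewrite bnd_simp.
Qed.

Lemma C1_scalar_derivative_continuous f f' : C1_scalar T f f' ->
  {within `[0, T], continuous f'}.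
Proof. by move=> hf; apply/subspace_continuousP => t /hf[]. Qed.

Lemma C1_scalar_FTC f f' : 0 < T -> C1_scalar T f f' ->
  \int[@lebesgue_measure R]_(t in `]0, T[) f' t = f T - f 0.
Proof.
move=> T0 hf.
have cf' := C1_scalar_derivative_continuous _ _ hf.
have cf := C1_scalar_continuous _ _ hf.
have dLR : derivable_oo_LRcontinuous f 0 T.
  have [_ f0 fT] := (continuous_within_itvP f T0).1 cf.
  by split => // t tT; have [] := C1_scalar_is_derive _ _ _ hf tT.
have f'E : {in `]0, T[, f^`()%classic =1 f'}.
  move=> t tT; have [_ <-] := C1_scalar_is_derive _ _ _ hf tT.
  by rewrite derive1E.
have := continuous_FTC2 T0 cf' dLR f'E; rewrite -EFinB => FTC.
have if' : (@lebesgue_measure R).-integrable `[0, T] (EFin \o f').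
  by apply: continuous_compact_integrable => //; exact: segment_compact.
rewrite Rintegral_itv_obnd_cbnd; last exact: continuous_integrable.
rewrite Rintegral_itv_bndo_bndc; first by rewrite /Rintegral FTC.
by apply: integrableS if' => //; apply: subset_itvl; rewrite bnd_simp.
Qed.

End C1Scalar.

Section C1ScalarAlgebra.
Context {R : realType} (T : R).

Lemma C1_scalarZ (a : R) (f f' : R -> R) : C1_scalar T f f' ->
  C1_scalar T (fun t => a * f t) (fun t => a * f' t).
Proof.
move=> hf t /hf[q c]; split; last exact: cvgMr.
under eq_fun do rewrite -mulrBr mulrCA.
exact: cvgMr.
Qed.

Lemma C1_scalarD (f f' g g' : R -> R) : C1_scalar T f f' -> C1_scalar T g g' ->
  C1_scalar T (fun t => f t + g t) (fun t => f' t + g' t).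
Proof.
move=> hf hg t tT; have [qf cf] := hf t tT; have [qg cg] := hg t tT.
split; last exact: cvgD.
under eq_fun do rewrite opprD addrACA mulrDr.
exact: cvgD.
Qed.

Lemma C1_scalar_sum (I : eqType) (r : seq I) (f f' : I -> R -> R) :
  {in r, forall i, C1_scalar T (f i) (f' i)} ->
  C1_scalar T (fun t => \sum_(i <- r) f i t) (fun t => \sum_(i <- r) f' i t).
Proof.
elim: r => [|i r IH] hf.
  move=> t _; rewrite !big_nil; split.
    under eq_fun do rewrite !big_nil subrr mulr0.
    exact: cvg_cst.
  under eq_fun do rewrite big_nil.
  exact: cvg_cst.
have consE (g : I -> R -> R) : (fun t => \sum_(j <- i :: r) g j t) =
    (fun t => g i t + \sum_(j <- r) g j t).
  by apply/funext => t; rewrite big_cons.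
rewrite !consE; apply: C1_scalarD; first by apply: hf; rewrite mem_head.
by apply: IH => j jr; apply: hf; rewrite inE jr orbT.
Qed.

End C1ScalarAlgebra.

(** * Forms along differentiable curves *)

Section FormsAlongCurves.
Context {R : realType} {E : lmodType R} (S : E -> Prop).
Hypothesis hS : lin_closed S.
Variables (B G : E -> E -> R) (M : R).
Hypotheses (hB : psd_form S B) (hG : psd_form S G).
Hypotheses (M0 : 0 <= M) (BG : forall u, S u -> B u u <= M * G u u).
Variables (T : R) (v dv : R -> E).
Hypothesis hv : C1_on (fun u => Num.sqrt (G u u)) T v dv.
Hypothesis Sv : forall t : R, t \in `[0, T] -> S (v t).
Hypothesis Sdv : forall t : R, t \in `[0, T] -> S (dv t).

Let quotient t s := (s - t)^-1 *: (v s - v t).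

Let Squotient (t : R) : t \in `[0, T] ->
  \forall s \near dnbhs_within `[0, T] t, S (quotient t s).
Proof.
move=> tT; apply: filterS (withinT _ _) => s sT.
by apply: (lin_closedZ _ hS); apply: (lin_closedB _ hS); exact: Sv.
Qed.

(** v s - v t is s - t times a difference quotient, and the quotients stay
    bounded for the seminorm because they converge. *)
Lemma C1_on_continuous (t : R) : t \in `[0, T] ->
  Num.sqrt (G (v s - v t) (v s - v t))
    @[s --> nbhs_within `[0, T] t] --> (0 : R).
Proof.
move=> tT; have [q _] := hv t tT.
have Svt := Sv t tT; have Sdvt := Sdv t tT.
have G0 : Num.sqrt (G (v t - v t) (v t - v t)) = 0.
  have S0 := lin_closed0 _ hS _ Svt.
  rewrite subrr -[X in G X _](scale0r (v t)).
  by rewrite (psd_formZ _ hS _ hG)// mul0r sqrtr0.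
rewrite -[X in _ --> X]G0.
apply: (@cvg_dnbhs_within _ _ (fun s => Num.sqrt (G (v s - v t) (v s - v t)))).
rewrite G0.
have lim : `|s - t| * Num.sqrt (G (quotient t s) (quotient t s))
    @[s --> dnbhs_within `[0, T] t] --> `|0 : R| * Num.sqrt (G (dv t) (dv t)).
  have limG : G (quotient t s) (quotient t s) @[s --> dnbhs_within `[0, T] t]
      --> G (dv t) (dv t).
    apply: (@psd_form_cvg _ _ _ hS G G 1) => //; try exact: Squotient.
    by move=> u _; rewrite mul1r.
  have limN : `|s - t| @[s --> dnbhs_within `[0, T] t] --> `|0 : R|.
    exact: cvg_norm (cvg_dnbhs_within_sub _ _).
  have limS : Num.sqrt (G (quotient t s) (quotient t s))
      @[s --> dnbhs_within `[0, T] t] --> Num.sqrt (G (dv t) (dv t)).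
    exact: (continuous_cvg _ (@sqrt_continuous R (G (dv t) (dv t))) limG).
  exact: cvgM limN limS.
rewrite normr0 mul0r in lim; apply: cvg_trans lim; apply: near_eq_cvg.
apply: filterS2 (dnbhs_within_neq _ t) (withinT _ _) => s st sT.
have Sd : S (v s - v t) by apply: (lin_closedB _ hS) => //; exact: Sv.
rewrite /quotient (psd_formZ _ hS _ hG)//; last exact: (lin_closedZ _ hS).
rewrite (psd_formZr _ hS _ hG)// mulrA -expr2 sqrtrM ?sqr_ge0// sqrtr_sqr.
by rewrite mulrA -normrM divff ?subr_eq0// normr1 mul1r.
Qed.

(** With q the difference quotient of v between t and s, the difference
    quotient of t |-> B (v t) (v t) is 2 B (v t) q + (s - t) B q q, and q
    converges to dv t. *)
Lemma C1_on_form :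
  C1_scalar T (fun t => B (v t) (v t)) (fun t => 2 * B (v t) (dv t)).
Proof.
move=> t tT; have [q c] := hv t tT.
have Svt := Sv t tT; have Sdvt := Sdv t tT.
split; last first.
  apply: cvgMr; apply: (@psd_form_cvg _ _ _ hS B G M) => //.
  - by apply: filterS (withinT _ _) => s; exact: Sv.
  - by apply: filterS (withinT _ _) => s; exact: Sdv.
  - exact: C1_on_continuous.
have lim1 : B (v t) (quotient t s) @[s --> dnbhs_within `[0, T] t]
    --> B (v t) (dv t).
  apply: (@psd_form_cvg _ _ _ hS B G M) => //.
  - exact: filterS (fun _ _ => Svt) (withinT _ _).
  - exact: Squotient.
  - have S0 := lin_closed0 _ hS _ Svt.
    rewrite subrr -[X in G X _](scale0r (v t)).
    by rewrite (psd_formZ _ hS _ hG)// mul0r sqrtr0; exact: cvg_cst.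
have lim2 : B (quotient t s) (quotient t s) @[s --> dnbhs_within `[0, T] t]
    --> B (dv t) (dv t).
  by apply: (@psd_form_cvg _ _ _ hS B G M) => //; exact: Squotient.
have lim :
    2 * B (v t) (quotient t s) + (s - t) * B (quotient t s) (quotient t s)
    @[s --> dnbhs_within `[0, T] t]
    --> 2 * B (v t) (dv t) + 0 * B (dv t) (dv t).
  exact: cvgD (cvgMr lim1) (cvgM (cvg_dnbhs_within_sub _ _) lim2).
rewrite mul0r addr0 in lim; apply: cvg_trans lim; apply: near_eq_cvg.
apply: filterS2 (dnbhs_within_neq _ t) (withinT _ _) => s st sT.
have Svs := Sv s sT.
have Sd : S (v s - v t) by apply: (lin_closedB _ hS).
rewrite /quotient (psd_formZ _ hS _ hB)//; last exact: (lin_closedZ _ hS).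
rewrite !(psd_formZr _ hS _ hB)//.
rewrite !mulrA mulfV ?subr_eq0// mul1r.
have e1 w : S w -> B w (v s - v t) = B (v s) w - B (v t) w.
  by move=> Sw; have [-> // _ _] := hB; rewrite (psd_formB _ _ hB).
have [BC _ _] := hB.
rewrite (psd_formB _ _ hB)// !e1// (BC (v t) (v s))//; ring.
Qed.

End FormsAlongCurves.

(** * Weighted L^2 forms *)

(** An open set is the union of the rational boxes that it contains. *)
Lemma open_measurable_plane (R : realType) (U : set (R * R)) :
  open U -> measurable U.
Proof.
move=> oU.
pose box (a b c d : rat) : set (R * R) :=
  `]ratr a, ratr b[%classic `*` `]ratr c, ratr d[%classic.
have -> : U = \bigcup_a \bigcup_b \bigcup_c \bigcup_d
    (if `[< box a b c d `<=` U >] then box a b c d else set0).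
  apply/seteqP; split=> [[x y] Uxy|p [a _ [b _ [c _ [d _]]]]]; last first.
    by case: ifPn => // /asboolP; exact.
  have [[/= X Y] [/= Xx Yy] XYU] : nbhs (x, y) U by exact: open_nbhs_nbhs.
  have ratbox (z : R) (Z : set R) : nbhs z Z ->
      exists a b : rat, [/\ z \in `]ratr a, ratr b[ & `]ratr a, ratr b[ `<=` Z].
    move=> [e /= e0 eZ].
    have /rat_in_itvoo[a /[!in_itv]/= /andP[a1 a2]] : z - e < z.
      by rewrite gtrBl.
    have /rat_in_itvoo[b /[!in_itv]/= /andP[b1 b2]] : z < z + e.
      by rewrite ltrDl.
    exists a, b; split; first by rewrite in_itv/= a2 b1.
    move=> w /=; rewrite in_itv/= => /andP[aw wb]; apply: eZ => /=.
    by rewrite ltr_distlC (lt_trans a1)// (lt_trans wb).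
  have [a [b [xab abX]]] := ratbox _ _ Xx.
  have [c [d [ycd cdY]]] := ratbox _ _ Yy.
  exists a => //; exists b => //; exists c => //; exists d => //.
  rewrite ifT//; apply/asboolP => -[z w] [/= zab wcd].
  by apply: XYU; split; [exact: abX|exact: cdY].
do 4 (apply: bigcupT_measurable_rat => ?).
by case: ifP => // _; exact: measurableX.
Qed.

(** x^-1 = x * (x^2)^(-1), also at 0, reduces the inverse to a real power of a
    nonnegative number. *)
Lemma measurable_invr (R : realType) :
  measurable_fun [set: R] (fun x : R => x^-1).
Proof.
have -> : (fun x : R => x^-1) = (fun x : R => x * ((x ^+ 2) `^ (-1))).
  apply/funext => x; rewrite powR_inv1 ?sqr_ge0//.
  have [->|x0] := eqVneq x 0; first by rewrite invr0 mul0r.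
  by field.
have mpow : measurable_fun [set: R] (fun x : R => x `^ (-1)).
  exact: measurable_powR.
have msqr : measurable_fun [set: R] (fun x : R => x ^+ 2).
  exact: measurable_funX.
exact: measurable_funM (measurableT_comp mpow msqr).
Qed.

(** R * R with the sigma-algebra of the definition of [leb2], which is
    convertible to the default one. *)
Notation plane R := (measurableTypeR R * measurableTypeR R)%type.

Section WeightedForms.
Context {R : realType} (Om : set (R * R)).
Hypothesis oOm : open Om.
Let mOm : @measurable _ (plane R) Om := open_measurable_plane R Om oOm.
Local Notation mu := (leb2 R).

Lemma L2_lin_closed : lin_closed (L2 Om).
Proof.
move=> a f g Lf Lg; rewrite /L2.
have -> : ((a *: f + g) \_ Om) = a *: (f \_ Om) + (g \_ Om).
  apply/funext => x; rewrite [RHS](_ : _ = a * (f \_ Om) x + (g \_ Om) x)//.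
  by rewrite /patch; case: ifP => //= _; rewrite mulr0 addr0.
have [_] := Lfun_submod_closed mu (lee1n 2).
exact.
Qed.

Lemma L2_integrableM f g : L2 Om f -> L2 Om g ->
  mu.-integrable Om (EFin \o (fun x => f x * g x)).
Proof.
move=> Lf Lg; apply/(integrable_mkcond _ mOm).
have /Lfun1_integrable := Lfun2_mul_Lfun1 Lf Lg.
apply: eq_integrable => // x _ /=.
by rewrite /patch; case: ifP => //= _; rewrite mulr0.
Qed.

Lemma L2_measurable f : L2 Om f -> @measurable_fun _ _ (plane R) R Om f.
Proof.
rewrite /L2 inE => /andP[+ _]; rewrite inE/= => mf.
exact/(measurable_restrictT _ mOm).
Qed.

Definition weight_form (w f g : R * R -> R) : R :=
  \int[mu]_(x in Om) (w x * (f x * g x)).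

Definition bounded_weight (w : R * R -> R) (M : R) : Prop :=
  @measurable_fun _ _ (plane R) R Om w /\
  {ae mu, forall x, Om x -> 0 <= w x <= M}.

Section OneWeight.
Variables (w : R * R -> R) (M : R).
Hypotheses (M0 : 0 <= M) (hw : bounded_weight w M).

(* [clip] is bounded everywhere, and replacing [w] by it changes no integral. *)
Let clip x := Num.max 0 (Num.min M (w x)).

Let clip_bounds x : 0 <= clip x <= M.
Proof. by rewrite /clip le_max lexx/= ge_max M0 ge_min lexx. Qed.

Let mclip : @measurable_fun _ _ (plane R) R Om clip.
Proof.
have [mw _] := hw.
apply: (@measurable_maxr _ _ _ _ (cst 0)); first exact: measurable_cst.
apply: (@measurable_minr _ _ _ _ (cst M)) => //; exact: measurable_cst.
Qed.

Let integrable_clip f g : L2 Om f -> L2 Om g ->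
  mu.-integrable Om (EFin \o (fun x => clip x * (f x * g x))).
Proof.
move=> Lf Lg.
have := integrableMr mOm mclip _ (L2_integrableM _ _ Lf Lg).
apply; exists M; split; first exact: num_real.
move=> y My x /= Omx; have /andP[c0 cM] := clip_bounds x.
by rewrite ger0_norm// (le_trans cM)// ltW.
Qed.

Let clipE h : @measurable_fun _ _ (plane R) R Om h ->
  \int[mu]_(x in Om) (w x * h x) = \int[mu]_(x in Om) (clip x * h x).
Proof.
move=> mh; have [mw bw] := hw.
rewrite /Rintegral; congr fine; apply: ae_eq_integral => //.
- by apply/measurable_EFinP; exact: measurable_funM.
- by apply/measurable_EFinP; exact: measurable_funM.
apply: negligibleS bw => x /= hx wx; apply: hx => Omx.
have /andP[w0 wM] := wx Omx.
by rewrite /clip (min_idPr wM) (max_idPr w0).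
Qed.

Let weight_formE f g : L2 Om f -> L2 Om g ->
  weight_form w f g = \int[mu]_(x in Om) (clip x * (f x * g x)).
Proof.
by move=> Lf Lg; apply: clipE; apply: measurable_funM; exact: L2_measurable.
Qed.

Lemma weight_form_sum f1 g1 f2 g2 :
  L2 Om f1 -> L2 Om g1 -> L2 Om f2 -> L2 Om g2 ->
  \int[mu]_(x in Om) (w x * (f1 x * g1 x + f2 x * g2 x)) =
  weight_form w f1 g1 + weight_form w f2 g2.
Proof.
move=> Lf1 Lg1 Lf2 Lg2; rewrite !weight_formE// clipE.
  rewrite -RintegralD//; [|exact: integrable_clip..].
  by apply: eq_Rintegral => x _; rewrite mulrDr.
by apply: measurable_funD; apply: measurable_funM; exact: L2_measurable.
Qed.

Lemma weight_form_psd : psd_form (L2 Om) (weight_form w).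
Proof.
split=> [f g Lf Lg|a f g h Lf Lg Lh|f Lf].
- by apply: eq_Rintegral => x _; rewrite [f x * _]mulrC.
- rewrite !weight_formE//; last exact: L2_lin_closed.
  rewrite -RintegralZl//; last exact: integrable_clip.
  rewrite -RintegralD//; last 2 first.
  + apply: eq_integrable (integrableZl mOm a (integrable_clip _ _ Lf Lh)) => //.
  + exact: integrable_clip.
  apply: eq_Rintegral => x _ /=.
  rewrite [(a *: f + g) x](_ : _ = a * f x + g x)//; ring.
- rewrite weight_formE//; apply: Rintegral_ge0 => x _.
  by rewrite -expr2 mulr_ge0 ?sqr_ge0//; case/andP: (clip_bounds x).
Qed.

Lemma weight_form_le f : L2 Om f -> weight_form w f f <= M * L2ip Om f f.
Proof.
move=> Lf; rewrite weight_formE// /L2ip.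
rewrite -RintegralZl//; last exact: L2_integrableM.
apply: le_Rintegral => //.
- exact: integrable_clip.
- exact: (integrableZl mOm M (L2_integrableM _ _ Lf Lf)).
- move=> x _; rewrite -expr2 ler_wpM2r ?sqr_ge0//.
  by case/andP: (clip_bounds x).
Qed.

End OneWeight.

Lemma L2ip_psd : psd_form (L2 Om) (L2ip Om).
Proof.
have -> : L2ip Om = weight_form (cst 1).
  apply/funext => f; apply/funext => g; apply: eq_Rintegral => x _ /=.
  by rewrite mul1r.
apply: (weight_form_psd _ 1) => //; split; first exact: measurable_cst.
by apply: aeW => x _ /=; rewrite ler01 lexx.
Qed.

End WeightedForms.

(** * The forms of the wave equation *)

Section WaveForms.
Context {R : realType} (Om : set (R * R)).
Hypothesis oOm : open Om.
Local Notation mu := (leb2 R).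

Definition L2_jet (u : jet R) : Prop :=
  [/\ L2 Om (jval u), L2 Om (jd1 u) & L2 Om (jd2 u)].

Definition H1ip (u w : jet R) : R :=
  L2ip Om (jval u) (jval w) + L2ip Om (jd1 u) (jd1 w) + L2ip Om (jd2 u) (jd2 w).

Lemma L2_jet_lin_closed : lin_closed L2_jet.
Proof.
move=> a u v [u0 u1 u2] [v0 v1 v2]; split.
- exact: (L2_lin_closed Om a (jval u) (jval v)).
- exact: (L2_lin_closed Om a (jd1 u) (jd1 v)).
- exact: (L2_lin_closed Om a (jd2 u) (jd2 v)).
Qed.

Lemma H10_L2_jet u : H10 Om u -> L2_jet u.
Proof. by move=> [[]]. Qed.

Lemma L2norm_sqr f : L2norm Om f ^+ 2 = L2ip Om f f.
Proof.
by rewrite sqr_sqrtr//; apply: Rintegral_ge0 => x _; rewrite -expr2 sqr_ge0.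
Qed.

Lemma H1normE u : H1norm Om u = Num.sqrt (H1ip u u).
Proof. by rewrite /H1norm !L2norm_sqr. Qed.

Lemma H1ip_psd : psd_form L2_jet H1ip.
Proof.
have ip := L2ip_psd Om oOm.
apply: psd_form_add; first apply: psd_form_add.
- by apply: (psd_form_comap _ _ _ _ (L2 Om) _ (@jval R) _ _ ip) => // u [].
- by apply: (psd_form_comap _ _ _ _ (L2 Om) _ (@jd1 R) _ _ ip) => // u [].
- by apply: (psd_form_comap _ _ _ _ (L2 Om) _ (@jd2 R) _ _ ip) => // u [].
Qed.

Variables (c : R -> R * R -> R) (z m M : R).
Hypotheses (m0 : 0 < m) (M0 : 0 <= M).
Hypothesis mc : @measurable_fun _ _ (plane R) R Om (c z).
Hypothesis bc : {ae mu, forall x, Om x -> m <= c z x <= M}.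

Lemma coefficient_weight : bounded_weight Om (c z) M.
Proof.
split => //; apply: negligibleS bc => x /= hx cx; apply: hx => Omx.
by have /andP[mx ->] := cx Omx; rewrite (le_trans (ltW m0)).
Qed.

Lemma coefficientV_weight : bounded_weight Om (fun x => (c z x)^-1) m^-1.
Proof.
split.
  exact: (@measurableT_comp _ _ _ (plane R) R R _ _ _ (measurable_invr R) mc).
apply: negligibleS bc => x /= hx cx; apply: hx => Omx.
have /andP[mx _] := cx Omx; have cgt0 := lt_le_trans m0 mx.
by rewrite invr_ge0 (ltW cgt0)/= lef_pV2.
Qed.

Lemma cformE f g : cform Om c z f g = weight_form Om (fun x => (c z x)^-1) f g.
Proof. by apply: eq_Rintegral => x _; rewrite mulrA. Qed.

Lemma cform_psd : psd_form (L2 Om) (cform Om c z).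
Proof.
have -> : cform Om c z = weight_form Om (fun x => (c z x)^-1).
  by apply/funext => f; apply/funext => g; exact: cformE.
apply: (weight_form_psd _ oOm _ m^-1); first by rewrite invr_ge0 ltW.
exact: coefficientV_weight.
Qed.

Lemma cform_le f : L2 Om f -> cform Om c z f f <= m^-1 * L2ip Om f f.
Proof.
move=> Lf; rewrite cformE; apply: weight_form_le => //.
  by rewrite invr_ge0 ltW.
exact: coefficientV_weight.
Qed.

Lemma aformE u w : L2_jet u -> L2_jet w ->
  aform Om c z u w =
  weight_form Om (c z) (jd1 u) (jd1 w) + weight_form Om (c z) (jd2 u) (jd2 w).
Proof.
move=> [_ u1 u2] [_ w1 w2]; apply: (weight_form_sum _ oOm _ M) => //.
exact: coefficient_weight.
Qed.

Lemma aform_psd : psd_form L2_jet (aform Om c z).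
Proof.
have wf := weight_form_psd _ oOm _ _ M0 coefficient_weight.
have [BC Blin B0] : psd_form L2_jet (fun u w =>
    weight_form Om (c z) (jd1 u) (jd1 w)
    + weight_form Om (c z) (jd2 u) (jd2 w)).
  apply: psd_form_add.
  - by apply: (psd_form_comap _ _ _ _ (L2 Om) _ (@jd1 R) _ _ wf) => // u [].
  - by apply: (psd_form_comap _ _ _ _ (L2 Om) _ (@jd2 R) _ _ wf) => // u [].
split=> [u w Su Sw|a u v w Su Sv Sw|u Su]; rewrite !aformE//.
- exact: BC.
- exact: Blin.
- exact: L2_jet_lin_closed.
- exact: B0.
Qed.

Lemma aform_le u : L2_jet u -> aform Om c z u u <= M * H1ip u u.
Proof.
move=> Lu; have [u0 u1 u2] := Lu; rewrite aformE// /H1ip -addrA mulrDr.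
apply: ler_wpDl.
  by rewrite mulr_ge0// -L2norm_sqr sqr_ge0.
by rewrite mulrDr lerD// weight_form_le//; exact: coefficient_weight.
Qed.

Lemma energyE u du : L2_jet u -> L2_jet du ->
  energy Om c z u du =
  cform Om c z (jval du) (jval du) + 2^-1 * aform Om c z u u.
Proof.
move=> Lu [Ldu _ _]; have [_ _ c0] := cform_psd; have [_ _ a0] := aform_psd.
by rewrite /energy !sqr_sqrtr ?c0 ?a0.
Qed.

End WaveForms.

(** * The stability estimate *)

(** Slices of a jointly measurable function are measurable; open sets being
    measurable, so is the slab on which the coefficient is. *)
Lemma coefficient_slice (R : realType) (Om : set (R * R)) (d1 d2 : R)
    (c : R -> R * R -> R) (z : R) :
  open Om -> coefficient Om d1 d2 c -> z \in `[d1, d2] ->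
  exists m M : R, [/\ 0 < m, 0 <= M, @measurable_fun _ _ (plane R) R Om (c z)
    & {ae leb2 R, forall x, Om x -> m <= c z x <= M}].
Proof.
move=> oOm [mc [m [M [m0 /(_ _ _)bc]]]] zD.
(* [M] is known to be nonnegative only if [Om] is nonempty *)
exists m, `|M|; split => //; last first.
  apply: negligibleS (bc z zD) => x /= hx cx; apply: hx => Omx.
  by have /andP[-> /le_trans->//] := cx Omx; rewrite ler_norm.
have mOm : measurable Om := open_measurable_plane R Om oOm.
apply: (@measurable_comp _ _ _ _ _ _ (`[d1, d2] `*` Om)
  (fun p : R * (R * R) => c p.1 p.2) _ (pair z)) => //.
- exact: measurableX.
- by move=> _ [x Omx <-]; split.
- exact: measurable_funTS (pair1_measurable z).
Qed.

Lemma node_in (R : realType) (d1 d2 : R) (K k : nat) :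
  d1 < d2 -> (0 < K)%N -> (k <= K)%N -> node d1 d2 K k \in `[d1, d2].
Proof.
move=> d12 K0 kK; rewrite in_itv/= /node /dz.
have KR : 0 < K%:R :> R by rewrite ltr0n.
have dge0 : 0 <= d2 - d1 by rewrite subr_ge0 ltW.
have kge0 : 0 <= k%:R * ((d2 - d1) / K%:R) by rewrite mulr_ge0// divr_ge0// ltW.
have kled : k%:R * ((d2 - d1) / K%:R) <= d2 - d1.
  by rewrite mulrCA ler_piMr// ler_pdivrMr// mul1r ler_nat.
by apply/andP; split; lra.
Qed.

Section Stability.
Context {R : realType} (Om : set (R * R)) (d1 d2 T : R) (c : R -> R * R -> R).
Hypotheses (oOm : open Om) (hD : d1 < d2) (hT : 0 < T).
Hypothesis hc : coefficient Om d1 d2 c.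
Variables (K : nat) (v dv : nat -> R -> jet R) (ddv : nat -> R -> R * R -> R).
Hypothesis K0 : (0 < K)%N.
Hypothesis regular :
  forall k, (k <= K)%N -> time_regular Om T (v k) (dv k) (ddv k).
Hypothesis discrete : quasi_time_discretization Om d1 d2 T c K v dv ddv.

Local Notation z k := (node d1 d2 K k).
Local Notation h := (dz d1 d2 K).

Let sqnorm k t := L2ip Om (jval (dv k t)) (jval (dv k t)).

Let dz_gt0 : 0 < h.
Proof. by rewrite divr_gt0 ?subr_gt0// ltr0n. Qed.

Let jetP k (t : R) : (k <= K)%N -> t \in `[0, T] ->
  [/\ L2_jet Om (v k t), L2_jet Om (dv k t) & L2 Om (ddv k t)].
Proof.
move=> kK tT; have [/(_ t tT)[Hv Hdv L] _ _] := regular k kK.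
by split => //; exact: H10_L2_jet.
Qed.

Let L2_dv k (t : R) : (k <= K)%N -> t \in `[0, T] -> L2 Om (jval (dv k t)).
Proof. by move=> kK tT; have [_ [L _ _] _] := jetP k t kK tT. Qed.

Lemma velocity_sqnorm_C1 k : (k <= K)%N ->
  C1_scalar T (sqnorm k) (fun t => 2 * L2ip Om (jval (dv k t)) (ddv k t)).
Proof.
move=> kK; have [_ _ hdv] := regular k kK.
have ip := L2ip_psd Om oOm.
apply: (C1_on_form _ (L2_lin_closed Om) _ _ 1 ip ip ler01 _ T
  (fun t => jval (dv k t)) (ddv k) hdv).
- by move=> u _; rewrite mul1r.
- by move=> t; exact: L2_dv.
- by move=> t tT; have [] := jetP k t kK tT.
Qed.

Lemma energy_C1 k : (k <= K)%N ->
  C1_scalar T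
    (fun t => cform Om c (z k) (jval (dv k t)) (jval (dv k t))
              + 2^-1 * aform Om c (z k) (v k t) (v k t))
    (fun t => 2 * cform Om c (z k) (jval (dv k t)) (ddv k t)
              + 2^-1 * (2 * aform Om c (z k) (v k t) (dv k t))).
Proof.
move=> kK; have [_ hv hdv] := regular k kK.
have zD := node_in R d1 d2 K k hD K0 kK.
have [m [M [m0 M0 mc bc]]] := coefficient_slice R Om d1 d2 c _ oOm hc zD.
apply: C1_scalarD; last apply: C1_scalarZ.
- apply: (C1_on_form _ (L2_lin_closed Om) _ _ m^-1
    (cform_psd Om oOm c (z k) m M m0 mc bc) (L2ip_psd Om oOm) _ _ T
    (fun t => jval (dv k t)) (ddv k) hdv).
  + by rewrite invr_ge0 ltW.
  + exact: (cform_le Om oOm c (z k) m M m0 mc bc).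
  + by move=> t; exact: L2_dv.
  + by move=> t tT; have [] := jetP k t kK tT.
- have hv' : C1_on (fun u => Num.sqrt (H1ip Om u u)) T (v k) (dv k).
    rewrite (_ : (fun u => _) = H1norm Om)//.
    by apply/funext => u; rewrite H1normE.
  apply: (C1_on_form _ (L2_jet_lin_closed Om) _ _ M
    (aform_psd Om oOm c (z k) m M m0 M0 mc bc) (H1ip_psd Om oOm) M0
    _ T (v k) (dv k) hv').
  + exact: (aform_le Om oOm c (z k) m M m0 M0 mc bc).
  + by move=> t tT; have [] := jetP k t kK tT.
  + by move=> t tT; have [] := jetP k t kK tT.
Qed.

(** The k-th equation tested with the k-th velocity, and (a - b, a - b) >= 0 for
    two consecutive velocities. *)
Lemma energy_dissipation k (t : R) : (1 <= k <= K)%N -> t \in `]0, T[ ->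
  h * (2 * cform Om c (z k) (jval (dv k t)) (ddv k t)
       + 2^-1 * (2 * aform Om c (z k) (v k t) (dv k t)))
  <= sqnorm k.-1 t - sqnorm k t.
Proof.
move=> /andP[k1 kK] tT.
have tT' : t \in `[0, T] by exact: subset_itv_oo_cc tT.
have tT'' : t \in `]0, T] by apply: subset_itv_oo_oc tT.
have k'K : (k.-1 <= K)%N by rewrite (leq_trans (leq_pred _)).
have [/(_ t tT')[_ H10dv L2ddv] _ _] := regular k kK.
have k1K : (1 <= k <= K)%N by rewrite k1.
have := discrete k t (dv k t) k1K tT'' H10dv.
have Lk := L2_dv k t kK tT'; have Lk' := L2_dv k.-1 t k'K tT'.
have cC : cform Om c (z k) (ddv k t) (jval (dv k t)) =
    cform Om c (z k) (jval (dv k t)) (ddv k t).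
  by apply: eq_Rintegral => x _; rewrite mulrAC.
rewrite cC.
have ip := L2ip_psd Om oOm.
have [_ _ /(_ _ (lin_closedB _ (L2_lin_closed Om) _ _ Lk Lk'))] := ip.
have [ipC _ _] := ip.
have LB := lin_closedB _ (L2_lin_closed Om) _ _ Lk Lk'.
rewrite (psd_formB _ _ ip)// !(ipC _ (_ - _))// !(psd_formB _ _ ip)//.
rewrite -/(sqnorm k t) -/(sqnorm k.-1 t) (ipC (jval (dv k.-1 t)))//.
set p := L2ip _ _ _; set C := cform _ _ _ _ _; set A := aform _ _ _ _ _.
move=> square eqn.
have -> : h * (2 * C + 2^-1 * (2 * A)) = - 2 * (sqnorm k t - p).
  have h0 : h != 0 by rewrite gt_eqF.
  have -> : A = - 2 * (C + h^-1 * (sqnorm k t - p)) by lra.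
  by field.
lra.
Qed.

Let energy_formE k t : (k <= K)%N -> t \in `[0, T] ->
  energy Om c (z k) (v k t) (dv k t) =
  cform Om c (z k) (jval (dv k t)) (jval (dv k t))
  + 2^-1 * aform Om c (z k) (v k t) (v k t).
Proof.
move=> kK tT.
have zD := node_in R d1 d2 K k hD K0 kK.
have [m [M [m0 M0 mc bc]]] := coefficient_slice R Om d1 d2 c _ oOm hc zD.
have [Lv Ldv _] := jetP k t kK tT.
exact: (energyE Om oOm c (z k) m M m0 M0 mc bc).
Qed.

Lemma velocity_energy_stability :
  L2L2norm Om T (fun t => jval (dv K t)) ^+ 2
  + h * \sum_(1 <= k < K.+1) energy Om c (z k) (v k T) (dv k T)
  <= L2L2norm Om T (fun t => jval (dv 0%N t)) ^+ 2
  + h * \sum_(1 <= k < K.+1) energy Om c (z k) (v k 0) (dv k 0).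
Proof.
pose e k t := cform Om c (z k) (jval (dv k t)) (jval (dv k t))
              + 2^-1 * aform Om c (z k) (v k t) (v k t).
pose e' k t := 2 * cform Om c (z k) (jval (dv k t)) (ddv k t)
              + 2^-1 * (2 * aform Om c (z k) (v k t) (dv k t)).
have eC1 : C1_scalar T (fun t => h * \sum_(1 <= k < K.+1) e k t)
                         (fun t => h * \sum_(1 <= k < K.+1) e' k t).
  apply: C1_scalarZ; apply: C1_scalar_sum => k.
  by rewrite mem_index_iota ltnS => /andP[_]; exact: energy_C1.
have isqnorm k : (k <= K)%N ->
    (@lebesgue_measure R).-integrable `]0, T[ (EFin \o sqnorm k).
  move=> /velocity_sqnorm_C1 /C1_scalar_continuous.
  exact: continuous_integrable.
have normE k : L2L2norm Om T (fun t => jval (dv k t)) ^+ 2 =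
    \int[@lebesgue_measure R]_(t in `]0, T[) sqnorm k t.
  rewrite sqr_sqrtr; last by apply: Rintegral_ge0 => t _; exact: sqr_ge0.
  by apply: eq_Rintegral => t _; rewrite L2norm_sqr.
have energies (t : R) : t \in `[0, T] ->
    \sum_(1 <= k < K.+1) energy Om c (z k) (v k t) (dv k t)
    = \sum_(1 <= k < K.+1) e k t.
  move=> tT; apply: eq_big_nat => k /andP[_ kK]; exact: energy_formE.
have T_in : T \in `[0, T] by rewrite in_itv/= lexx ltW.
have zero_in : 0 \in `[0, T] by rewrite in_itv/= lexx ltW.
have sideE k (t : R) : t \in `[0, T] ->
    L2L2norm Om T (fun s => jval (dv k s)) ^+ 2
    + h * \sum_(1 <= j < K.+1) energy Om c (z j) (v j t) (dv j t)
    = \int[@lebesgue_measure R]_(s in `]0, T[) sqnorm k s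
      + h * \sum_(1 <= j < K.+1) e j t.
  by move=> tT; congr (_ + h * _); [exact: normE|exact: energies].
rewrite [leLHS](sideE K T T_in) [leRHS](sideE 0%N 0 zero_in).
have FTC := C1_scalar_FTC T _ _ hT eC1.
have le_int :
    \int[@lebesgue_measure R]_(t in `]0, T[) (h * \sum_(1 <= k < K.+1) e' k t)
    <= \int[@lebesgue_measure R]_(t in `]0, T[) (sqnorm 0 t - sqnorm K t).
  apply: le_Rintegral => //.
  - exact/continuous_integrable/C1_scalar_derivative_continuous/eC1.
  - apply: eq_integrable (integrableB _ (isqnorm 0%N _) (isqnorm K _)) => //.
  move=> t /= tT; rewrite mulr_sumr.
  have -> : sqnorm 0 t - sqnorm K t =
      \sum_(1 <= k < K.+1) (sqnorm k.-1 t - sqnorm k t).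
    rewrite big_add1/= -opprB -(telescope_sumr (fun k => sqnorm k t))// -sumrN.
    by apply: eq_bigr => k _; rewrite opprB.
  by apply: ler_sum_nat => k kK; exact: energy_dissipation.
move: le_int; rewrite FTC RintegralB ?isqnorm//.
have key (a b x y : R) : x - y <= a - b -> b + x <= a + y by lra.
exact: key.
Qed.

End Stability.

Theorem lemma2p1 (R : realType) (Om : set (R * R)) (d1 d2 T : R)
    (c : R -> R * R -> R)
    (hOm : bounded_domain Om) (hD : d1 < d2) (hT : 0 < T)
    (hc : coefficient Om d1 d2 c) :
  exists C : R, 0 < C /\
    forall (K : nat) (v dv : nat -> R -> jet R) (ddv : nat -> R -> R * R -> R),
      (0 < K)%N ->
      (forall k, (k <= K)%N -> time_regular Om T (v k) (dv k) (ddv k)) ->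
      quasi_time_discretization Om d1 d2 T c K v dv ddv ->
      L2L2norm Om T (fun t => jval (dv K t)) ^+ 2
      + dz d1 d2 K
        * \sum_(1 <= k < K.+1) energy Om c (node d1 d2 K k) (v k T) (dv k T)
      <= C * (L2L2norm Om T (fun t => jval (dv 0%N t)) ^+ 2
              + dz d1 d2 K
                * \sum_(1 <= k < K.+1)
                    energy Om c (node d1 d2 K k) (v k 0) (dv k 0)).
Proof.
exists 1; split => // K v dv ddv K0 regular discrete; rewrite mul1r.
have [oOm _ _ _] := hOm.
exact: (velocity_energy_stability Om d1 d2 T c oOm hD hT hc K v dv ddv).
Qed.
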